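(* Let $b:\mathbb{Z}_{\geq 0}\to\mathbb{Z}$ satisfy (1) $b(0)$ is odd; (2) $4\mid (\Delta b)(x)$ for all $x\in\mathbb{Z}_{\geq 0}$; (3) $2^n\mid (\Delta^n b)(x)$ for all integers $n\geq 2$ and all $x\in\mathbb{Z}_{\geq 0}$. Then for every nonnegative integer $n$, \[\xi_2(C_n^b)=\xi_2(C_n)=s_2(n+1)-1.\]
   Context: For $f:\mathbb{Z}_{\geq0}\to\mathbb{Z}$, $(\Delta f)(x)=f(x+1)-f(x)$ and $\Delta^n$ is its $n$-fold iterate. A Dyck path of semilength $n$ is a sequence of lattice points $(x_0,y_0)=(0,0),(x_1,y_1),\dots,(x_{2n},y_{2n})=(2n,0)$ with all $y_k\ge 0$ and each step $(x_k-x_{k-1},y_k-y_{k-1})$ equal to $(1,1)$ or $(1,-1)$. For $b:\mathbb{Z}_{\geq0}\to\mathbb{Z}$, an up-step $(1,1)$ starting at height $y_{k-1}$ has weight $b(y_{k-1})$ and a down-step has weight $1$; the weight of a path is the product of the weights of its steps. The weighted Catalan number $C_n^b$ is the sum of the weights of all Dyck paths of semilength $n$; $C_n=\frac{1}{n+1}\binom{2n}{n}$ is the case $b\equiv 1$. For a nonzero integer $N$, $\xi_2(N)$ is the exponent of the largest power of $2$ dividing $N$, and $s_2(N)$ is the sum of the binary digits of $N$. *)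

(* Defs.v *)
From mathcomp Require Import all_boot all_order all_algebra.

Set Implicit Arguments.
Unset Strict Implicit.
Unset Printing Implicit Defensive.

Import Order.TTheory GRing.Theory Num.Theory.
Local Open Scope ring_scope.

Definition fdiff (f : nat -> int) (x : nat) : int := f x.+1 - f x.

Definition up_step : int * int := (1, 1).
Definition down_step : int * int := (1, -1).

(* p lists the 2n + 1 lattice points (x_k, y_k) of the path. *)
Definition dyck_path (n : nat) (p : seq (int * int)) : bool :=
  [&& size p == (2 * n).+1,
      p`_0 == (0, 0),
      p`_(2 * n) == ((2 * n)%N%:Z, 0),
      all (fun u => 0 <= u.2) p
    & [forall k : 'I_(2 * n),
         (p`_k.+1 - p`_k == up_step) || (p`_k.+1 - p`_k == down_step)]].

Definition step_weight (b : nat -> int) (u v : int * int) : int :=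
  if v - u == up_step then b `|u.2|%N else 1.

Definition path_weight (b : nat -> int) (p : seq (int * int)) : int :=
  \prod_(k < (size p).-1) step_weight b p`_k p`_k.+1.

(* The path from the origin whose k-th step is up iff the k-th bit is true. *)
Definition lattice_path (w : seq bool) : seq (int * int) :=
  (0, 0) :: scanl (fun u (c : bool) => u + (if c then up_step else down_step))
                  (0, 0) w.

(* The index set of step words makes the sum finite; by dyck_path_word below,
   each Dyck path of semilength n occurs in it exactly once. *)
Definition weighted_catalan (b : nat -> int) (n : nat) : int :=
  \sum_(w : (2 * n).-tuple bool | dyck_path n (lattice_path w))
     path_weight b (lattice_path w).

(* The division is exact, see mul_catalan. *)
Definition catalan (n : nat) : nat := ('C(2 * n, n) %/ n.+1)%N.

(* Meaningful for N != 0 only: xi2 0 = 0. *)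
Definition xi2 (N : int) : nat := logn 2 `|N|%N.

(* Since N < 2 ^ N, the range i < N covers all nonzero binary digits. *)
Definition s2 (N : nat) : nat := (\sum_(i < N) (N %/ 2 ^ i) %% 2)%N.

Lemma mul_catalan n : (n.+1 * catalan n = 'C(2 * n, n))%N.
Proof.
rewrite mulnC divnK //.
have h : (n.+1 * 'C(2 * n, n.+1) = n * 'C(2 * n, n))%N.
  by rewrite mul_bin_left mul2n -addnn addnK.
have : (n.+1 %| n * 'C(2 * n, n))%N by rewrite -h dvdn_mulr.
by rewrite Gauss_dvdr // coprimeSn.
Qed.

Lemma dyck_path_word n p : dyck_path n p ->
  exists! w : (2 * n).-tuple bool, lattice_path w = p.
Proof.
pose f (u : int * int) (c : bool) := u + (if c then up_step else down_step).
have step_inj : forall (u : int * int), injective (f u).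
  by move=> u [] [] /addrI.
have scan_inj : forall s t u, scanl f u s = scanl f u t -> s = t.
  elim=> [|c s IH] [|d t] u // e.
  have ecd : f u c = f u d by exact: (congr1 (head u) e).
  have := congr1 behead e; rewrite /= ecd => /IH ->.
  by rewrite (step_inj _ _ _ ecd).
have ex : forall s u,
  (forall k, (k < size s)%N -> ((u :: s)`_k.+1 - (u :: s)`_k == up_step)
      || ((u :: s)`_k.+1 - (u :: s)`_k == down_step)) ->
  exists2 w : seq bool, size w = size s & scanl f u w = s.
  elim=> [|v s IH] u h; first by exists [::].
  have [k hk|w sw ew] := IH v; first exact: (h k.+1 hk).
  have fE : f u (v - u == up_step) = v.
    have := h 0%N isT; rewrite /= /f.
    by case: eqP => [<- _|_ /= /eqP <-]; rewrite addrC subrK.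
  by exists ((v - u == up_step) :: w); rewrite /= ?sw // fE ew.
case/and5P; case: p => [//|u s] /= /eqP [sz] /eqP -> _ _ /forallP st.
have [k|w sw ew] := ex s (0, 0).
  by rewrite sz => hk; exact: (st (Ordinal hk)).
have szw : size w == (2 * n)%N by rewrite sw sz.
exists (Tuple szw); split; first by rewrite /lattice_path /= -ew.
by move=> t et; apply/val_inj/(scan_inj _ _ (0, 0)); rewrite ew; case: et.
Qed.

(* Main.v *)
(* Call [f] dyadic of order [p] when [2^(n+p)] divides [Delta^n f] for all [n].
   Products add orders and [Delta] raises the order by one, so shifting the
   argument does not change a function modulo the next order.  Write [C_n(x)]
   for the weighted Catalan number of [y |-> b (x + y)].  First passage gives
   [C_(n+1)(x) = b(x) sum_i C_i(x) C_(n-i)(x+1)], which the normalisation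
   [A_n = (n+1)! C_n] turns into a binomial convolution, where the terms [i] and
   [n-i] pair up to supply a factor 2 at each step.  By induction
   [A_n = 2^n t_n] modulo order [n+1], where [t_0 = 1], [t_n = b] for odd [n]
   and [t_n(x) = b(x) (b(x) + b(x+1)) / 2] for even [n > 0]: this sequence
   solves the recursion because [b^2 = 1] modulo order 1.  As [t_n(0)] is odd,
   the 2-adic valuation of [C_n(0)] is [n] minus that of [(n+1)!], as for the
   ordinary Catalan numbers, and Legendre's formula concludes. *)
Require Import Defs.
From mathcomp Require Import all_boot all_order all_algebra.
From mathcomp Require Import ring zify.

Set Implicit Arguments.
Unset Strict Implicit.
Unset Printing Implicit Defensive.

Import Order.TTheory GRing.Theory Num.Theory.
Local Open Scope ring_scope.

(** * Calculus of dyadic functions *)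

Definition dyadic (p : nat) (f : nat -> int) : Prop :=
  forall n x, (2 ^+ (n + p) %| iter n fdiff f x)%Z.

Lemma eq_iter_fdiff n f g : f =1 g -> iter n fdiff f =1 iter n fdiff g.
Proof.
by move=> e; elim: n => //= n IH x; rewrite /fdiff !IH.
Qed.

Lemma eq_dyadic p f g : f =1 g -> dyadic p f -> dyadic p g.
Proof. by move=> e h n x; rewrite -(eq_iter_fdiff n e). Qed.

Lemma dyadicD p f g :
  dyadic p f -> dyadic p g -> dyadic p (fun x => f x + g x).
Proof.
move=> hf hg n x.
suff -> : iter n fdiff (fun x => f x + g x) x =
    iter n fdiff f x + iter n fdiff g x.
  exact: rpredD.
by elim: n x {hf hg} => //= n IH x; rewrite /fdiff !IH; ring.
Qed.

Lemma dyadic_cst p (a : int) : (2 ^+ p %| a)%Z -> dyadic p (fun=> a).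
Proof.
move=> ha [|n] x //; rewrite iterSr (@eq_iter_fdiff _ _ (fun=> 0)); last first.
  by move=> y; rewrite /fdiff subrr.
suff -> : iter n fdiff (fun=> 0) x = 0 by exact: dvdz0.
by elim: n x => //= n IH x; rewrite /fdiff !IH subrr.
Qed.

Lemma dyadic_sum p (I : Type) (r : seq I) (F : I -> nat -> int) :
  (forall i, dyadic p (F i)) -> dyadic p (fun x => \sum_(i <- r) F i x).
Proof.
move=> hF; elim: r => [|i r IH].
  by apply: eq_dyadic (dyadic_cst (dvdz0 _)) => x; rewrite big_nil.
by apply: eq_dyadic (dyadicD (hF i) IH) => x; rewrite big_cons.
Qed.

Lemma dyadic_fdiff p f : dyadic p f -> dyadic p.+1 (fdiff f).
Proof. by move=> hf n x; rewrite addnS -addSn -iterSr; exact: hf. Qed.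

Lemma dyadic_shift p f : dyadic p f -> dyadic p (fun x => f x.+1).
Proof.
move=> hf n x.
suff -> : iter n fdiff (fun x => f x.+1) x = iter n fdiff f x.+1 by exact: hf.
by elim: n x {hf} => //= n IH x; rewrite /fdiff !IH.
Qed.

(** Discrete Leibniz rule: [Delta (f g)] is [Delta f] times [g] plus the shift of [f] times
    [Delta g]. Each summand has order [p + q + 1], so the induction on [n] needs all orders and
    functions at once. *)
Lemma dyadicM p q f g :
  dyadic p f -> dyadic q g -> dyadic (p + q) (fun x => f x * g x).
Proof.
move=> hf hg n; elim: n p q f g hf hg => [|n IH] p q f g hf hg x.
  by rewrite add0n exprD; apply: dvdz_mul; [exact: (hf 0%N) | exact: (hg 0%N)].
rewrite iterSr addSn -addnS.
have h1 := IH _ _ _ _ (dyadic_fdiff hf) hg.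
have h2 := IH _ _ _ _ (dyadic_shift hf) (dyadic_fdiff hg).
suff -> : iter n fdiff (fdiff (fun x => f x * g x)) x =
    iter n fdiff (fun x => fdiff f x * g x) x
    + iter n fdiff (fun x => f x.+1 * fdiff g x) x.
  by apply: rpredD; [move: (h1 x); rewrite addSn | move: (h2 x); rewrite addnS].
rewrite (@eq_iter_fdiff _ _ (fun x => fdiff f x * g x + f x.+1 * fdiff g x)).
  by elim: n x {IH h1 h2} => //= n IH x; rewrite /fdiff !IH; ring.
by move=> y; rewrite /fdiff; ring.
Qed.

Lemma dyadicMn p f (k : int) (q : nat) : (2 ^+ q %| k)%Z ->
  dyadic p f -> dyadic (q + p) (fun x => k * f x).
Proof. by move=> hk hf; apply: dyadicM => //; apply: dyadic_cst. Qed.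

Lemma dyadicZ p f (k : int) : dyadic p f -> dyadic p (fun x => k * f x).
Proof. by move=> hf; apply: (@dyadicMn p f k 0). Qed.

Lemma dyadicW p q f : (p <= q)%N -> dyadic q f -> dyadic p f.
Proof.
move=> le_pq hf n x; apply: dvdz_trans (hf n x).
by rewrite dvdz_exp2l // leq_add2l.
Qed.

Lemma dyadic_half p f : dyadic p.+1 (fun x => 2 * f x) -> dyadic p f.
Proof.
move=> hf n x; have := hf n x.
have -> : iter n fdiff (fun x => 2 * f x) x = 2 * iter n fdiff f x.
  by elim: n x {hf} => //= n IH x; rewrite /fdiff !IH; ring.
by rewrite addnS exprS dvdz_mul2l.
Qed.

(** Oddness serves the value itself, through [(f - 1) (f + 1)]. The differences follow from
    [Delta (f^2) = Delta f (2 f + Delta f)], a product of two factors of order 1. *)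
Lemma dyadic_sqr_odd f : dyadic 0 f -> (forall x, (2 %| f x - 1)%Z) ->
  dyadic 1 (fun x => f x * f x - 1).
Proof.
move=> hf odd_f [|n] x.
  rewrite /= expr1 (_ : _ - _ = (f x - 1) * (f x + 1)); last by ring.
  by apply: dvdz_mulr (odd_f x).
rewrite iterSr addn1.
suff h : dyadic 2 (fdiff (fun x => f x * f x - 1)).
  by have := h n x; rewrite addn2.
apply: (@eq_dyadic _ (fun x => fdiff f x * (2 * f x + fdiff f x))).
  by move=> y; rewrite /fdiff; ring.
apply: (@dyadicM 1 1); first exact: dyadic_fdiff.
by apply: dyadicD; [apply: (@dyadicMn 0 _ 2 1) | apply: dyadic_fdiff].
Qed.

(** * Weighted walks and the Catalan recursion *)

(** Total weight of the nonnegative walks of [l] steps from height [y] down to height 0, split by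
    the first step. *)
Fixpoint walks (b : nat -> int) (l y : nat) : int :=
  if l is l'.+1 then
    b y * walks b l' y.+1 + (if y is y'.+1 then walks b l' y' else 0)
  else (y == 0)%N%:R.

Lemma eq_walks b b' l y : b =1 b' -> walks b l y = walks b' l y.
Proof.
by move=> e; elim: l y => //= l IH y; rewrite e IH; case: y => // y; rewrite IH.
Qed.

Lemma walks_odd b l y : odd (l + y) -> walks b l y = 0.
Proof.
elim: l y => [|l IH] [|y] //= h.
  by rewrite IH ?mulr0 ?addr0 //; move: h; rewrite !addnS.
by rewrite !IH ?mulr0 ?addr0 //; move: h; rewrite !addnS //= negbK.
Qed.

(* First passage from height y + 1 to height 0: the walk stays above 1 until
   the step number j + 1, which descends to 0. *)
Lemma walks_first_passage b l y :
  walks b l y.+1 =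
    \sum_(j < l) walks (b \o succn) j y * walks b (l - j.+1) 0.
Proof.
elim: l y => [|l IH] y; first by rewrite big_ord0.
rewrite big_ord_recl subSS subn0.
under eq_bigr => j _ do rewrite lift0 subSS /= mulrDl -mulrA.
rewrite big_split /= -mulr_sumr -IH addrCA; congr (_ + _).
case: y => [|y]; last by rewrite mul0r add0r -IH.
by rewrite mul1r big1 ?addr0 // => j _; rewrite mul0r.
Qed.

Lemma sum_even_ord (V : nmodType) (F : nat -> V) n :
  (forall i, odd i -> F i = 0) ->
  \sum_(j < n.*2.+1) F j = \sum_(i < n.+1) F i.*2.
Proof.
move=> F0; elim: n => [|n IH]; first by rewrite !big_ord1.
rewrite [RHS]big_ord_recr -IH doubleS !big_ord_recr /= (F0 n.*2.+1) ?addr0 //=.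
by rewrite odd_double.
Qed.

Definition catalan_at (b : nat -> int) (n x : nat) : int :=
  walks (fun y => b (x + y)%N) n.*2 0.

(** The first step is up, with weight [b x]; the first return to 0 then splits the path. Parity
    leaves only even lengths, and the index is reversed so that [i] counts the part after the
    return. *)
Lemma catalan_at_rec b n x :
  catalan_at b n.+1 x =
    b x * \sum_(i < n.+1) catalan_at b i x * catalan_at b (n - i) x.+1.
Proof.
rewrite {1}/catalan_at doubleS [LHS]/= addr0 addn0.
congr (_ * _).
rewrite -/(walks _ n.*2.+1 1) walks_first_passage.
pose F j := walks (fun y => b (x.+1 + y)%N) j 0
  * walks (fun y => b (x + y)%N) (n.*2.+1 - j.+1) 0.
rewrite (eq_bigr (fun j : 'I_(n.*2.+1) => F j)); last first.
  by move=> j _; congr (_ * _); apply: eq_walks => y /=; rewrite addnS.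
rewrite sum_even_ord => [|i odd_i]; last by rewrite /F walks_odd ?mul0r ?addn0.
rewrite (reindex_inj rev_ord_inj) /=; apply: eq_bigr => i _.
rewrite /F /catalan_at mulrC subSS.
by congr (walks _ _ _ * walks _ _ _); have := ltn_ord i; lia.
Qed.

(** * Dyck paths as step words *)

Lemma big_tuple_cons (V : nmodType) (T : finType) l
    (P : pred (seq T)) (F : seq T -> V) :
  \sum_(w : l.+1.-tuple T | P w) F w =
  \sum_c \sum_(w : l.-tuple T | P (c :: w)) F (c :: w).
Proof.
rewrite pair_big_dep /=.
rewrite (reindex (fun p : T * l.-tuple T => cons_tuple p.1 p.2)) //=.
exists (fun w : l.+1.-tuple T => (thead w, behead_tuple w)) => [[c w] _|w _] /=.
  by congr (_, _); apply: val_inj.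
by rewrite [in RHS](tuple_eta w); apply: val_inj.
Qed.

Definition lattice_step (u : int * int) (c : bool) : int * int :=
  u + (if c then up_step else down_step).

Definition returning (u : int * int) (w : seq bool) : bool :=
  all (fun v : int * int => 0 <= v.2) (scanl lattice_step u w)
  && ((last u (scanl lattice_step u w)).2 == 0).

Lemma sum_returning b l (a : int) (y : nat) :
  \sum_(w : l.-tuple bool | returning (a, y%:Z) w)
     path_weight b ((a, y%:Z) :: scanl lattice_step (a, y%:Z) w) = walks b l y.
Proof.
elim: l a y => [|l IH] a y.
  rewrite big_mkcond (eq_bigr (fun=> (y == 0%N)%:R)); last first.
    move=> w _; rewrite tuple0 /= /returning /= /path_weight big_ord0.
    by case: y.
  by rewrite sumr_const card_tuple expn0 mulr1n.
rewrite (@big_tuple_cons _ _ _ (returning (a, y%:Z)) (fun w =>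
  path_weight b ((a, y%:Z) :: scanl lattice_step (a, y%:Z) w))) big_bool /=.
congr (_ + _).
  have e : lattice_step (a, y%:Z) true = (a + 1, y.+1%:Z).
    by rewrite /lattice_step /= -addn1 PoszD.
  rewrite -(IH (a+1)) mulr_sumr; apply: eq_big => [w|w _].
    by rewrite /returning /= e.
  rewrite /path_weight /= big_ord_recl /= e; congr (_ * _).
  rewrite /step_weight /= (_ : _ - _ == _) //.
  by rewrite /up_step xpair_eqE; apply/andP; split => /=; lia.
case: y => [|y].
  (* A down-step from height 0 reaches height -1, so no word contributes. *)
  by rewrite big_pred0 // => w; rewrite /returning.
have e : lattice_step (a, y.+1%:Z) false = (a + 1, y%:Z).
  by rewrite /lattice_step /=; congr (_, _) => /=; lia.
rewrite -(IH (a+1)); apply: eq_big => [w|w _].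
  by rewrite /returning /= e.
rewrite /path_weight /= big_ord_recl /= e -[RHS]mul1r; congr (_ * _).
rewrite /step_weight /= ifN //.
by rewrite xpair_eqE negb_and; apply/orP; right => /=; lia.
Qed.

Lemma nth_lattice_step (u : int * int) w k : (k < size w)%N ->
  exists c, (u :: scanl lattice_step u w)`_k.+1
    - (u :: scanl lattice_step u w)`_k = if c then up_step else down_step.
Proof.
elim: w u k => [|c w IH] u [|k] //= h; last exact: IH.
by exists c; rewrite /lattice_step addrC addKr.
Qed.

Lemma last_lattice_step (u : int * int) w :
  (last u (scanl lattice_step u w)).1 = u.1 + (size w)%:Z.
Proof.
elim: w u => [|c w IH] u /=; first by rewrite addr0.
by rewrite IH /lattice_step; case: c => /=; lia.
Qed.

(** A word of length [2 * n] forces the number of points, the origin, the legal steps and the final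
    abscissa; only the conditions on heights remain. *)
Lemma dyck_path_returning n (w : (2 * n).-tuple bool) :
  dyck_path n (lattice_path w) = returning (0, 0) w.
Proof.
have sz := size_tuple w.
rewrite /dyck_path /lattice_path -/lattice_step /returning.
set s := scanl _ _ _.
have szs : size s = (2 * n)%N by rewrite size_scanl.
rewrite /= szs !eqxx /= andbA.
have -> : [forall k : 'I_(2 * n),
    (s`_k - ((0, 0) :: s)`_k == up_step)
    || (s`_k - ((0, 0) :: s)`_k == down_step)].
  apply/forallP => k; have [|c] := @nth_lattice_step (0, 0) w k.
    by rewrite sz.
  by rewrite -/s /= => ->; case: c; rewrite eqxx ?orbT.
rewrite andbT andbC; congr (_ && _).
have -> : ((0, 0) :: s)`_(2 * n) = last (0, 0) s.
  by rewrite -szs; exact: (nth_last 0 ((0, 0) :: s)).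
have := last_lattice_step (0, 0) w; rewrite -/s sz /= add0r.
by case: (last _ _) => x y /= ->; rewrite xpair_eqE eqxx.
Qed.

Lemma weighted_catalan_at b n : weighted_catalan b n = catalan_at b n 0.
Proof.
rewrite /weighted_catalan (eq_bigl _ _ (@dyck_path_returning n)).
by rewrite (sum_returning b _ 0 0) mul2n.
Qed.

(** * Binary digits and the valuation of Catalan numbers *)

Lemma s2_trunc N k : (N <= k)%N -> s2 N = (\sum_(i < k) (N %/ 2 ^ i) %% 2)%N.
Proof.
move=> le_Nk; rewrite /s2.
rewrite (big_ord_widen _ (fun i => (N %/ 2 ^ i) %% 2)%N le_Nk).
rewrite [RHS](bigID (fun i : 'I_k => (i < N)%N)) /=.
rewrite [X in (_ + X)%N]big1 ?addn0 //.
move=> i; rewrite -leqNgt => le_Ni; rewrite divn_small //.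
exact: leq_ltn_trans le_Ni (ltn_expl _ _).
Qed.

Lemma logn2_fact m : (logn 2 m`! + s2 m = m)%N.
Proof.
rewrite logn_fact // (@s2_trunc m m.+1) // big_add1 /= big_mkord.
(* Legendre's sum telescopes: the quotient by [2 ^ k] is twice the next quotient plus the digit
   number [k]. *)
have h k : (\sum_(i < k) m %/ 2 ^ i.+1
    + \sum_(i < k) (m %/ 2 ^ i) %% 2 + m %/ 2 ^ k = m)%N.
  elim: k => [|k IH]; first by rewrite !big_ord0 divn1.
  rewrite !big_ord_recr /=.
  have := divn_eq (m %/ 2 ^ k) 2; rewrite -divnMA -expnSr; move: IH.
  move: (m %/ 2 ^ k)%N (_ %/ 2 ^ k.+1)%N => q q'.
  move: (\sum_(i < k) _)%N (\sum_(i < k) _)%N (q %% 2)%N => X Y r; lia.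
rewrite big_ord_recr /= -[in RHS](h m).
by rewrite (divn_small (ltn_expl m (isT : 1 < 2)%N)) mod0n !addn0.
Qed.

(** Take valuations in [(n+1) C_n n! n! = (2n)!] and apply Legendre's formula; [2n] and [n] have the
    same digit sum. *)
Lemma logn2_catalan n : (logn 2 (catalan n) + logn 2 n.+1`! = n)%N.
Proof.
have cat0 : (0 < catalan n)%N.
  have := mul_catalan n; case: (catalan n) => // /esym/eqP.
  by rewrite muln0 -leqn0 leqNgt bin_gt0 leq_pmull.
have := bin_fact (leq_pmull n (isT : 0 < 2)%N); rewrite -mul_catalan.
have -> : (2 * n - n = n)%N by lia.
move/(congr1 (logn 2)); rewrite factS !lognM ?muln_gt0 ?fact_gt0 ?cat0 //.
have := logn2_fact (2 * n); have := logn2_fact n.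
suff -> : s2 (2 * n) = s2 n.
  by move: (s2 n) (logn 2 _) (logn 2 _) (logn 2 _) (logn 2 _); lia.
rewrite (@s2_trunc n (2 * n)) ?leq_pmull // (@s2_trunc (2 * n) (2 * n).+1) //.
rewrite big_ord_recl /= divn1 modnMr add0n; apply: eq_bigr => i _.
by rewrite /bump /= add1n expnS divnMl.
Qed.

(** * Binomial convolution of the leading terms *)

Lemma sum_bin_succ m (f : nat -> int) :
  \sum_(j < m.+2) 'C(m.+1, j)%:Z * f j =
  \sum_(j < m.+1) 'C(m, j)%:Z * (f j + f j.+1).
Proof.
under [RHS]eq_bigr do rewrite mulrDr.
rewrite big_split /= big_ord_recl bin0.
rewrite (eq_bigr (fun j : 'I_m.+1 =>
  'C(m, j.+1)%:Z * f j.+1 + 'C(m, j)%:Z * f j.+1)); last first.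
  by move=> j _; rewrite lift0 binS PoszD mulrDl.
rewrite big_split /= addrA; congr (_ + _).
by rewrite big_ord_recr [in RHS]big_ord_recl /= bin0 bin_small // mul0r addr0.
Qed.

(** Pascal's rule groups neighbouring values, leaving [K] times a full row sum of binomials. The
    hypothesis holds for functions of the parity of [j]. *)
Lemma sum_bin_pairs m (f : nat -> int) (K : int) :
  (forall j, f j + f j.+1 = K) ->
  \sum_(j < m.+2) 'C(m.+1, j)%:Z * f j = 2 ^+ m * K.
Proof.
move=> hK; rewrite sum_bin_succ.
under eq_bigr do rewrite hK.
rewrite -mulr_suml; congr (_ * _).
rewrite -[2]/(1 + 1 : int) exprDn; apply: eq_bigr => j _.
by rewrite !expr1n mulr1 -natz.
Qed.

(* [u] stands for [x |-> b x * (b x + b x.+1) / 2]. *)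
Definition leading (b u : nat -> int) (n x : nat) : int :=
  if n == 0%N then 1 else if odd n then b x else u x.

Lemma dyadic_leading b u n :
  dyadic 0 b -> dyadic 0 u -> dyadic 0 (leading b u n).
Proof.
move=> hb hu; rewrite /leading; case: (n == 0)%N; first exact: dyadic_cst.
by case: (odd n).
Qed.

(** With [j = i + 1] the terms follow the parity pattern [g], except that [t_0] is 1 instead of [u].
    The full sum of [g] comes from [sum_bin_pairs]; the ends [j = 0] and [j = k + 3] are subtracted,
    and the two terms containing [t_0], both with coefficient [k + 3], are corrected. *)
Lemma sum_leading b u k x :
  let s := leading b u k.+1 in
  let r := leading b u k.+2 in
  \sum_(i < k.+2) 'C(k.+3, i.+1)%:Z
      * (leading b u i x * leading b u (k.+1 - i) x.+1) =
  2 ^+ k.+2 * (b x * r x.+1 + u x * s x.+1) - b x * r x.+1 - r x * b x.+1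
   + k.+3%:Z * ((1 - u x) * s x.+1 + s x * (1 - u x.+1)).
Proof.
move=> s r.
pose p c y := if c then b y else u y : int.
pose g j := p (~~ odd j) x * p (odd (k + j)) x.+1.
have gE j : g j + g j.+1 = b x * r x.+1 + u x * s x.+1.
  rewrite /g /s /r /leading /= addnS /= oddD.
  by case: (odd k); case: (odd j); rewrite /= ?negbK /p; ring.
have := sum_bin_pairs k.+2 gE.
rewrite big_ord_recl big_ord_recr big_ord_recl big_ord_recr /=.
rewrite [in X in _ -> X]big_ord_recl [in X in _ -> X]big_ord_recr /=.
under eq_bigr do rewrite /bump /= !add1n.
under [in X in _ -> X]eq_bigr do rewrite /bump /= !add1n.
rewrite /bump /= !add1n bin0 bin1 binSn binn subnn subn0.
set M := \sum_(i < k) _; set M' := \sum_(i < k) _.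
have -> : M' = M.
  apply: eq_bigr => i _; congr (_ * _); rewrite /g /leading /= negbK.
  have -> : (k.+1 - i.+1 == 0)%N = false by have := ltn_ord i; lia.
  rewrite subSS oddB ?(ltnW (ltn_ord i)) // /p oddD /=.
  by case: (odd k); case: (odd i).
rewrite /g /s /r /leading /= !oddD /= ?negbK /p.
by case: (odd k) => /= /eqP; rewrite -subr_eq0 => /eqP e;
  apply: subr0_eq; rewrite -[RHS]e; ring.
Qed.

Lemma dyadic_leading_sum b u n :
  dyadic 0 b -> dyadic 0 u -> dyadic 1 (fun x => b x * b x - 1) ->
  (forall x, 2 * u x = b x * (b x + b x.+1)) ->
  dyadic 2 (fun x =>
    b x * \sum_(i < n.+1) 'C(n.+2, i.+1)%:Z *
            (leading b u i x * leading b u (n - i) x.+1)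
    - 2 * leading b u n.+1 x).
Proof.
move=> hb hu hb2 uE; case: n => [|k].
  apply: eq_dyadic (dyadic_cst (dvdz0 _)) => x.
  by rewrite big_ord1 /leading /= bin1; ring.
have hdb := dyadic_fdiff hb; have hdu := dyadic_fdiff hu.
have hbb := dyadicM hb hb.
have d4 (j : int) f : dyadic 0 f -> dyadic 2 (fun x => 4 * j * f x).
  by move=> hf; apply: (@dyadicMn 0 _ _ 2) => //; apply: dvdz_mulr.
have d2 (j : int) f : dyadic 1 f -> dyadic 2 (fun x => 2 * j * f x).
  by move=> hf; apply: (@dyadicMn 1 _ _ 1) => //; apply: dvdz_mulr.
have E f : dyadic 0 f -> dyadic 0 (fun x => f x.+1) by apply: dyadic_shift.
have [[q kE]|[q kE]] : (exists q, k = q.*2) \/ (exists q, k = q.*2.+1).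
- have := odd_double_half k.
  by case: (odd k) => e; [right|left]; exists k./2; exact: esym e.
(* Here [s = b] and [r = u]. The function in [hK] is [b (b u' + u b')], primes denoting shifts; its
   coefficient outside the power of 2 is [-(k + 4)], which is even. By [uE] the remaining terms sum
   to [2 (k + 2) u]. *)
- have hK : dyadic 1 (fun x =>
      b x * (2 * (b x * u x) + (b x * fdiff u x + u x * fdiff b x))).
    apply: (@dyadicM 0 1) => //; apply: dyadicD.
      by apply: (@dyadicMn 0 _ 2 1) => //; apply: (dyadicM hb hu).
    by apply: dyadicD; apply: (@dyadicM 0 1).
  apply: eq_dyadic (dyadicD (d4 (2 ^+ k) _
      (dyadicM hb (dyadicD (dyadicM hb (E _ hu)) (dyadicM hu (E _ hb)))))
      (dyadicD (d2 (- q.+2%:Z) _ hK) (d4 q.+1%:Z _ hu))) => x.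
  rewrite sum_leading /leading /= kE odd_double /= -kE /fdiff.
  have -> : k.+3%:Z = 2 * q%:Z + 3 by lia.
  have -> : q.+2%:Z = q%:Z + 2 by lia.
  have -> : q.+1%:Z = q%:Z + 1 by lia.
  have := uE x => /eqP; rewrite -subr_eq0 => /eqP e.
  apply: subr0_eq; rewrite -[RHS](mulr0 (2 * q%:Z + 3)) -[in RHS]e !exprS; ring.
(* Here [s = u] and [r = b], and [k + 3] is even. The terms [-2 b (b b') - 2 b] become
   [-2 b (b^2 - 1) - 4 b - 2 b^2 Delta b], which is where [b^2 = 1] modulo order 1 enters. *)
apply: eq_dyadic (dyadicD (d4 (2 ^+ k) _
    (dyadicM hb (dyadicD (dyadicM hb (E _ hb)) (dyadicM hu (E _ hu)))))
  (dyadicD (d2 (-1) _ (@dyadicM 0 1 _ _ hb hb2))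
  (dyadicD (d4 (-1) _ hb)
  (dyadicD (d2 (-1) _ (@dyadicM 0 1 _ _ hbb hdb))
  (dyadicD (d4 q.+2%:Z _ (dyadicM hb hu))
  (dyadicD (d2 q.+2%:Z _ (@dyadicM 0 1 _ _ hb hdu))
  (d4 (- q.+2%:Z) _ (dyadicM hb (dyadicM hu (E _ hu)))))))))) => x.
rewrite sum_leading /leading /= kE /= odd_double /= -kE /fdiff.
have -> : k.+3%:Z = 2 * q%:Z + 4 by lia.
have -> : q.+2%:Z = q%:Z + 2 by lia.
by rewrite !exprS; ring.
Qed.

Lemma dyadic_catalan_at b u n :
  dyadic 0 b -> dyadic 0 u -> dyadic 1 (fun x => b x * b x - 1) ->
  (forall x, 2 * u x = b x * (b x + b x.+1)) ->
  dyadic n.+1 (fun x =>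
    n.+1`!%:Z * catalan_at b n x - 2 ^+ n * leading b u n x).
Proof.
move=> hb hu hb2 uE.
pose t := leading b u; pose A i x := i.+1`!%:Z * catalan_at b i x.
pose d i x := A i x - 2 ^+ i * t i x.
have ht i : dyadic 0 (t i) by apply: dyadic_leading.
(* Since [(i + 1) + (m - i + 1) = m + 2], the factorials of the two factors combine with the
   binomial into [(m + 2)!]. *)
have ARec m x : A m.+1 x =
    b x * \sum_(i < m.+1) 'C(m.+2, i.+1)%:Z * (A i x * A (m - i)%N x.+1).
  rewrite /A catalan_at_rec mulrCA; congr (_ * _); rewrite mulr_sumr.
  apply: eq_bigr => i _; have le_im := ltn_ord i.
  rewrite -(@bin_fact m.+2 i.+1) ?(leqW le_im) //.
  have -> : (m.+2 - i.+1 = (m - i).+1)%N by lia.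
  by rewrite !PoszM; ring.
elim/ltn_ind: n => -[|m] IH.
  apply: eq_dyadic (dyadic_cst (dvdz0 _)) => x.
  by [].
have hd i : (i <= m)%N -> dyadic i.+1 (d i) by move=> le_im; apply: IH.
have p2 i p f : dyadic p f -> dyadic (i + p) (fun x => 2 ^+ i * f x).
  by move=> hf; apply: dyadicMn.
pose B (i : 'I_m.+1) := 'C(m.+2, i.+1)%:Z.
have le_im (i : 'I_m.+1) : (i <= m)%N by rewrite -ltnS.
have le_mim (i : 'I_m.+1) : (m - i <= m)%N by rewrite leq_subr.
(* Expanding [A_i (A_(m-i) o succ)] with [A_i = 2^i t_i + d_i], the terms linear
   in [d] are symmetric under [i -> m - i], up to the higher order sum [R]. *)
pose R x := \sum_(i < m.+1) B i * (d i x * d (m - i)%N x.+1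
  + 2 ^+ i * (t i x * fdiff (d (m - i)%N) x)
  + 2 ^+ (m - i) * (d i x * fdiff (t (m - i)%N) x)).
pose S x := \sum_(i < m.+1) B i * (2 ^+ i * (t i x * d (m - i)%N x)).
(* Each summand reaches order [m + 2]: the first as [(i + 1) + (m - i + 1)], the other two because a
   difference adds one order. In [S] no difference occurs, so one order is missing until the factor
   2 supplies it. *)
have hR : dyadic m.+2 R.
  apply: dyadic_sum => i; apply: dyadicZ; apply: dyadicD; first apply: dyadicD.
  - have := dyadicM (hd _ (le_im i)) (dyadic_shift (hd _ (le_mim i))).
    by apply: dyadicW; have := le_im i; lia.
  - have := p2 i _ _ (dyadicM (ht i) (dyadic_fdiff (hd _ (le_mim i)))).
    by apply: dyadicW; have := le_im i; lia.
  - have := p2 (m - i)%N _ _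
      (dyadicM (hd _ (le_im i)) (dyadic_fdiff (ht (m - i)%N))).
    by apply: dyadicW; have := le_im i; lia.
have hS : dyadic m.+1 S.
  apply: dyadic_sum => i; apply: dyadicZ.
  have := p2 i _ _ (dyadicM (ht i) (hd _ (le_mim i))).
  by apply: dyadicW; have := le_im i; lia.
have hS2 : dyadic m.+2 (fun x => 2 * S x) by apply: (@dyadicMn _ _ 2 1).
have hL : dyadic m.+2 (fun x => 2 ^+ m *
    (b x * (\sum_(i < m.+1) B i * (t i x * t (m - i)%N x.+1)) - 2 * t m.+1 x)).
  by rewrite -addn2; apply: p2; apply: dyadic_leading_sum.
apply: eq_dyadic (dyadicD hL (@dyadicM 0 _ _ _ hb (dyadicD hR hS2))) => x.
rewrite -/(A _ _) ARec -/(t _ _).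
have S' : S x = \sum_(i < m.+1) B i * (2 ^+ (m - i) * (t (m - i)%N x * d i x)).
  rewrite /S (reindex_inj rev_ord_inj); apply: eq_bigr => i _ /=.
  rewrite /B /= subSS subKn //; congr (_ * _).
  rewrite -(@bin_sub m.+2 i.+1) // ?(leqW (ltn_ord i)) //.
  by congr (Posz (binomial _ _)); have := le_im i; lia.
suff -> : \sum_(i < m.+1) B i * (A i x * A (m - i)%N x.+1) =
   2 ^+ m * \sum_(i < m.+1) B i * (t i x * t (m - i)%N x.+1) + R x + 2 * S x.
  by rewrite exprS; ring.
have -> : 2 * S x = S x + S x by ring.
rewrite {1}S' /S /R mulr_sumr -!big_split /=; apply: eq_bigr => i _.
have -> : 2 ^+ m = 2 ^+ i * 2 ^+ (m - i) :> int by rewrite -exprD subnKC.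
by rewrite /fdiff /d; ring.
Qed.

(** * Conclusion at the origin *)

Lemma logn2_odd_multiple n (a t : int) :
  ~~ (2 %| t)%Z -> (2 ^+ n.+1 %| a - 2 ^+ n * t)%Z ->
  a != 0 /\ logn 2 `|a|%N = n.
Proof.
move=> odd_t /dvdzP [q /eqP]; rewrite subr_eq => /eqP aE.
have {aE} aE : a = 2 ^+ n * (2 * q + t) by rewrite aE exprS; ring.
have odd_qt : ~~ (2 %| 2 * q + t)%Z by rewrite rpredDl ?dvdz_mulr.
have qt0 : 2 * q + t != 0 by apply: contraNneq odd_qt => ->.
split; first by rewrite aE mulf_neq0 // expf_neq0.
rewrite aE abszM abszX lognM ?expn_gt0 ?absz_gt0 // pfactorK //.
by rewrite (@logn_coprime 2 `|_|%N) ?addn0 // prime_coprime.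
Qed.

Theorem theorem2p1 (b : nat -> int)
    (b0_odd : ~~ (2 %| b 0%N)%Z)
    (diff1 : forall x : nat, (4 %| fdiff b x)%Z)
    (diffn : forall n x : nat, (2 <= n)%N -> (2 ^+ n %| iter n fdiff b x)%Z)
    (n : nat) :
  [/\ weighted_catalan b n != 0,
      xi2 (weighted_catalan b n) = xi2 (catalan n)%:Z
    & xi2 (catalan n)%:Z = (s2 n.+1 - 1)%N].
Proof.
have hb : dyadic 0 b.
  case=> [|[|k]] x; rewrite addn0 //; last exact: diffn.
  by apply: dvdz_trans (diff1 x).
(* As [b x.+1 = b x + 2 * h x], the half [b x * (b x + b x.+1) / 2] is [b x * (b x + h x)].
   Divisibility of [Delta b] by 4 makes [h] even, so [u 0] is odd. *)
pose h x := (fdiff b x %/ 2)%Z.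
have hE x : 2 * h x = fdiff b x.
  by rewrite mulrC divzK //; apply: dvdz_trans (diff1 x).
have h_even x : (2 %| h x)%Z by rewrite -(@dvdz_mul2l 2) // hE; exact: diff1.
have hh : dyadic 0 h.
  by apply: dyadic_half; apply: eq_dyadic (dyadic_fdiff hb) => x; rewrite hE.
pose u x := b x * (b x + h x).
have hu : dyadic 0 u by apply: (@dyadicM 0 0) => //; apply: dyadicD.
have uE x : 2 * u x = b x * (b x + b x.+1).
  by rewrite /u mulrCA mulrDr hE /fdiff; ring.
have b_odd x : (2 %| b x - 1)%Z.
  elim: x => [|x IH]; first by move: b0_odd; lia.
  have -> : b x.+1 - 1 = fdiff b x + (b x - 1) by rewrite /fdiff; ring.
  by rewrite rpredD //; apply: dvdz_trans (diff1 x).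
have u0_odd : ~~ (2 %| u 0%N)%Z.
  rewrite /u dvdzE abszM Euclid_dvdM // negb_or; apply/andP; split=> //.
  by apply: contra b0_odd => b_h_even; rewrite -(addrK (h 0%N) (b 0%N)) rpredB.
have t0_odd : ~~ (2 %| leading b u n 0%N)%Z.
  by rewrite /leading; case: (n == 0)%N => //; case: (odd n).
(* The zeroth difference at 0 gives [(n+1)! C_n^b = 2^n t_n(0)] modulo [2^(n+1)], so the left side
   has valuation exactly [n]. *)
have := dyadic_catalan_at n hb hu (dyadic_sqr_odd hb b_odd) uE 0%N 0%N.
rewrite add0n /= -weighted_catalan_at => /(logn2_odd_multiple t0_odd) [].
rewrite mulf_eq0 negb_or => /andP [_ w0].
rewrite abszM /= lognM ?fact_gt0 ?absz_gt0 // => wE.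
have := logn2_catalan n; have := logn2_fact n.+1.
by rewrite /xi2 /=; split => //; move: wE; lia.
Qed.
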